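(* Let $m$, $n$ and $r$ be non-negative integers. If $\{(s_k),(\sigma_k)\}$ and $\{(t_k),(\tau_k)\}$, $k=0,1,2,\ldots$, are binomial-transform pairs of the first kind, then \[ \sum_{k=0}^n (-1)^k\binom nk s_{n-k+m}\sum_{q=0}^r(-1)^q\binom rq \tau_{k+q} = \sum_{k=0}^n(-1)^k\binom nk t_{n-k+r}\sum_{p=0}^m(-1)^p\binom mp\sigma_{k+p}. \]
   Context: Two sequences $(s_k)_{k\ge0}$ and $(\sigma_k)_{k\ge0}$ of complex numbers form a binomial-transform pair of the first kind if $\sigma_n=\sum_{k=0}^n(-1)^k\binom nk s_k$ for every non-negative integer $n$. *)

(* Defs.v *)
From mathcomp Require Import all_boot all_order all_algebra.
From mathcomp Require Import reals.
From mathcomp Require Import complex.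

Set Implicit Arguments.
Unset Strict Implicit.
Unset Printing Implicit Defensive.

Import GRing.Theory.
Local Open Scope ring_scope.
Local Open Scope complex_scope.

(* The complex numbers are R[i] with R an arbitrary model of the real numbers
   (a realType). *)
Definition binomial_pair1 (R : realType) (s sigma : nat -> R[i]) : Prop :=
  forall n : nat,
    sigma n = \sum_(0 <= k < n.+1) (-1) ^+ k * 'C(n, k)%:R * s k.

(* Main.v *)
Require Import Defs.
From mathcomp Require Import all_boot all_order all_algebra.
From mathcomp Require Import reals.
From mathcomp Require Import complex.
From mathcomp Require Import ring.

(** Write [D] for the binomial transform of the first kind and [E] for the shift.
    Since [D f n] is [(1 - E)^n f] at [0], applying the order-[r] transform to a
    shift of [tau = D t] amounts to transforming [E^r t].  Both sides
    then have the form [\sum_k (-1)^k C(n, k) S_(n-k) (D T)_k] with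
    [S = E^m s], [T = E^r t] and the roles of [S] and [T] exchanged; this form
    is symmetric, because its recursion in [n] is. *)

Import GRing.Theory.
Local Open Scope ring_scope.
Local Open Scope complex_scope.

Definition binomial_transform (A : comNzRingType) (f : nat -> A) (n : nat) : A :=
  \sum_(0 <= k < n.+1) (-1) ^+ k * 'C(n, k)%:R * f k.

Lemma eq_binomial_transform (A : comNzRingType) (f g : nat -> A) (n : nat) :
  (forall k, (k <= n)%N -> f k = g k) ->
  binomial_transform A f n = binomial_transform A g n.
Proof.
by move=> efg; apply: eq_big_nat => k /andP[_ kn]; rewrite efg.
Qed.

Lemma binomial_transformB (A : comNzRingType) (f g : nat -> A) (n : nat) :
  binomial_transform A (fun k => f k - g k) n =
  binomial_transform A f n - binomial_transform A g n.
Proof. by rewrite -sumrB; apply: eq_bigr => k _; rewrite mulrBr. Qed.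

(** Pascal's rule, or [(1 - E)^(n+1) = (1 - E)^n - (1 - E)^n E] in terms of the shift. *)
Lemma binomial_transformS (A : comNzRingType) (f : nat -> A) (n : nat) :
  binomial_transform A f n.+1 =
  binomial_transform A f n - binomial_transform A (fun k => f k.+1) n.
Proof.
rewrite /binomial_transform big_nat_recl // bin0.
under eq_bigr => k _ do rewrite binS natrD mulrDr mulrDl.
rewrite big_split /= addrA; congr (_ + _); last first.
  by rewrite -sumrN; apply: eq_bigr => k _; rewrite exprS; ring.
(* The top term carries ['C(n, n.+1) = 0], so the sum shortens to the range of the order-[n]
   transform. *)
rewrite big_nat_recr //= bin_small // mulr0 mul0r addr0.
by rewrite [RHS]big_nat_recl // bin0.
Qed.

Lemma binomial_transform_shift (A : comNzRingType) (f : nat -> A) (r k : nat) :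
  binomial_transform A (fun q => binomial_transform A f (k + q)) r =
  binomial_transform A (fun j => f (j + r)%N) k.
Proof.
elim: r k => [|r IHr] k.
  rewrite {1}/binomial_transform big_nat1 bin0 expr0 !mul1r addn0.
  by apply: eq_binomial_transform => j _; rewrite addn0.
rewrite binomial_transformS IHr.
rewrite (eq_binomial_transform _ (fun q => binomial_transform A f (k + q.+1))
  (fun q => binomial_transform A f (k.+1 + q))); last first.
  by move=> q _; rewrite addSnnS.
(* With [X] and [Y] the transforms at [k] of [f] shifted by [r] and by [r.+1], the goal's left side
   is [X - (X - Y) = Y]. *)
rewrite IHr binomial_transformS opprB addrC subrK.
by apply: eq_binomial_transform => j _; rewrite addSnnS.
Qed.

Definition transform_convolution (A : comNzRingType) (f g : nat -> A) (n : nat) : A :=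
  binomial_transform A (fun k => f (n - k)%N * binomial_transform A g k) n.

(** Pascal's rule yields two sums: in the first, [n.+1 - k = (n - k).+1] shifts [f]; in the second,
    the transform of [g] at [k.+1] splits again by the same rule. *)
Lemma transform_convolutionS (A : comNzRingType) (f g : nat -> A) (n : nat) :
  transform_convolution A f g n.+1 =
  transform_convolution A (fun k => f k.+1) g n
  - transform_convolution A f g n
  + transform_convolution A f (fun k => g k.+1) n.
Proof.
rewrite {1}/transform_convolution binomial_transformS -addrA; congr (_ + _).
  by apply: eq_binomial_transform => k kn; rewrite subSn.
rewrite [RHS]addrC -opprB /transform_convolution -binomial_transformB; congr (- _).
apply: eq_binomial_transform => k _.
by rewrite subSS binomial_transformS mulrBr.
Qed.

(** Exchanging [f] and [g] swaps the outer terms of the recursion and keeps the middle one; the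
    induction must therefore range over all [f] and [g]. *)
Lemma transform_convolutionC (A : comNzRingType) (f g : nat -> A) (n : nat) :
  transform_convolution A f g n = transform_convolution A g f n.
Proof.
elim: n f g => [|n IHn] f g.
  rewrite /transform_convolution /binomial_transform !big_nat1 /=.
  by ring.
rewrite !transform_convolutionS (IHn _ g) (IHn f g) (IHn f (fun k => g k.+1)).
by rewrite addrAC [RHS]addrAC; congr (_ - _); rewrite addrC.
Qed.

Theorem theorem11 (R : realType) (m n r : nat) (s sigma t tau : nat -> R[i])
    (hs : binomial_pair1 s sigma) (ht : binomial_pair1 t tau) :
  \sum_(0 <= k < n.+1) (-1) ^+ k * 'C(n, k)%:R * s (n - k + m)%N *
    (\sum_(0 <= q < r.+1) (-1) ^+ q * 'C(r, q)%:R * tau (k + q)%N)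
  = \sum_(0 <= k < n.+1) (-1) ^+ k * 'C(n, k)%:R * t (n - k + r)%N *
    (\sum_(0 <= p < m.+1) (-1) ^+ p * 'C(m, p)%:R * sigma (k + p)%N).
Proof.
(* Stated for a generic pair so that it serves both sides, with [s] and [t] exchanged. *)
have side a b (f g h : nat -> R[i]) : binomial_pair1 g h ->
    \sum_(0 <= k < n.+1) (-1) ^+ k * 'C(n, k)%:R * f (n - k + a)%N *
      (\sum_(0 <= q < b.+1) (-1) ^+ q * 'C(b, q)%:R * h (k + q)%N)
    = transform_convolution _ (fun j => f (j + a)%N) (fun j => g (j + b)%N) n.
  move=> hgh; apply: eq_bigr => k _; rewrite -mulrA; congr (_ * (_ * _)).
  rewrite -binomial_transform_shift.
  by apply: eq_bigr => q _; rewrite hgh.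
by rewrite (side _ _ _ _ _ ht) (side _ _ _ _ _ hs) transform_convolutionC.
Qed.
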